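(* Let $F\subseteq L$ be a field extension. (a) If $\mathrm{trdeg}_F L=0$, then $\mathrm{Zar}(L|F)=\{L\}=\mathrm{Zar}_{\min}(L|F)$, and in particular they are Noetherian spaces. (b) If $\mathrm{trdeg}_F L\geq 2$, then $\mathrm{Zar}(L|F)$ and $\mathrm{Zar}_{\min}(L|F)$ are not Noetherian spaces.
   Context: For an integral domain $D$ contained in a field $K$, $\mathrm{Zar}(K|D)$ is the set of all valuation domains that contain $D$ and have quotient field $K$ (including $K$ itself), endowed with the Zariski topology: a subbasis of open sets is given by the sets $\{V\in\mathrm{Zar}(K|D)\mid x_1,\ldots,x_n\in V\}$, as $x_1,\ldots,x_n$ range in $K$. $\mathrm{Zar}_{\min}(K|D)$ is the subspace of the elements of $\mathrm{Zar}(K|D)$ that are minimal with respect to containment. A topological space is Noetherian if its open sets satisfy the ascending chain condition (equivalently, every subset is compact, where compact does not include Hausdorff). *)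

(* Defs.v *)
From HB Require Import structures.
From mathcomp Require Import all_boot all_order all_algebra.
From mathcomp Require Import mathcomp_extra boolp classical_sets functions.
From mathcomp Require Import cardinality topology.
(* The notations of mpoly clash with those of mathcomp-analysis. *)
From mathcomp Require Import -(notations) mpoly.

Set Implicit Arguments.
Unset Strict Implicit.
Unset Printing Implicit Defensive.

Import GRing.Theory.

Local Open Scope ring_scope.
Local Open Scope classical_set_scope.
Local Open Scope card_scope.

Section Zar.
Variable K : fieldType.

Definition valuation_domain (V : set K) : Prop :=
  subring_closed [in V] /\
  (forall a b : K, V a -> V b ->
    (exists2 c, V c & b = c * a) \/ (exists2 c, V c & a = c * b)).

Definition has_quotient_field (V : set K) : Prop :=
  forall x : K, exists a b : K, [/\ V a, V b, b != 0 & x = a / b].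

Definition Zar (D : set K) : set (set K) :=
  [set V | [/\ valuation_domain V, has_quotient_field V & D `<=` V]].

Definition Zar_min (D : set K) : set (set K) :=
  [set V | Zar D V /\ forall W, Zar D W -> W `<=` V -> W = V].

(* A copy of the subtype [set_type (Zar D)], which carries the Zariski
   topology. *)
Definition zar_space (D : set K) : Type := set_type (Zar D).

Section ZariskiTopology.
Variable D : set K.

HB.instance Definition _ := Choice.copy (zar_space D) (set_type (Zar D)).

(* The subbasic open set of the valuation domains containing x_1, ..., x_n,
   for xs the sequence x_1, ..., x_n. *)
Definition zar_subbase (xs : seq K) : set (zar_space D) :=
  [set V | [set` xs] `<=` set_val V].

HB.instance Definition _ :=
  @isSubBaseTopological.Build (zar_space D) _ (range zar_subbase) id.
End ZariskiTopology.

(* [set_type] of a subset of a topological space has the subspace topology. *)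
Definition zar_min_space (D : set K) : topologicalType :=
  set_type [set V : zar_space D | Zar_min D (set_val V)].

End Zar.

Definition noetherian_space (T : topologicalType) : Prop :=
  forall U : nat -> set T,
    (forall n, open (U n)) -> (forall n, U n `<=` U n.+1) ->
    exists N, forall n, (N <= n)%N -> U n = U N.

Section TranscendenceDegree.
(* The field extension F <= L is represented by the embedding iota. *)
Variables (F L : fieldType) (iota : {rmorphism F -> L}).

(* [mmap iota v p] is the value p(v_1, ..., v_n) in L. *)
Definition algebraically_independent (B : set L) : Prop :=
  forall (n : nat) (v : 'I_n -> L), injective v -> (forall i, B (v i)) ->
  forall p : mpoly n F, mmap iota v p = 0 -> p = 0.

Definition transcendence_basis (B : set L) : Prop :=
  algebraically_independent B /\
  forall C, algebraically_independent C -> B `<=` C -> C = B.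

(* All transcendence bases have the same cardinality, the transcendence
   degree, so that it suffices to compare the cardinality of one of them. *)
Definition trdeg_eq (n : nat) : Prop :=
  exists2 B, transcendence_basis B & B #= `I_n.

Definition trdeg_ge (n : nat) : Prop :=
  exists2 B, transcendence_basis B & `I_n #<= B.

End TranscendenceDegree.

(* Main.v *)
Require Import Defs.
From HB Require Import structures.
From mathcomp Require Import all_boot all_order all_algebra.
From mathcomp Require Import finmap.
From mathcomp Require Import mathcomp_extra boolp classical_sets functions.
From mathcomp Require Import cardinality topology.
From mathcomp Require Import ring.
From mathcomp Require Import -(notations) mpoly.

(** If [L] is algebraic over [F], every [x] in [L] lies in every valuation ring
  [V] of [L] over [F], because [V] is integrally closed
  ([root_in_valuation]); hence [L] is the only such ring and the spaces are
  points.

  Suppose now that [s] and [t] are algebraically independent over [F], and let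
  [O i] be the open set of the valuation rings that contain [s ^ (i+1) / t].
  The unions [O 0 `|` ... `|` O n] form an ascending chain; it does not
  stabilise as soon as, for every [n], some point lies in [O n] but in no [O i]
  with [i < n] ([not_noetherian_of_separated]).  It is enough to find such a
  point that is minimal in [Zar(L|F)], which settles both spaces at once.  The
  monomial valuation of [F(s, t)] with [s] of weight [2] and [t] of weight
  [2n+1] gives [s ^ (i+1) / t] the weight [2(i-n) + 1], which is positive for
  [i = n] and negative for [i < n].  What is missing is a minimal valuation
  ring of [L] whose maximal ideal contains all elements of positive weight.

  Such rings are produced by one application of Zorn's lemma.  Consider the
  subsets [S] of [L] that contain [0], are stable under subtraction,
  multiplication and multiplication by [F], and do not contain [1].  The
  maximal ideal of a valuation ring over [F] is one of them
  ([max_ideal_proper]); the elements of positive weight form another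
  ([positive_weight_proper]), because algebraic independence makes the weight
  well defined.  If [S] is maximal among them, the argument of Chevalley's
  extension theorem shows that [{x | x S `<=` S}] is a valuation ring
  ([idealizer_total]), and it is a minimal one because a smaller valuation ring
  would have a larger maximal ideal ([idealizer_min]). *)

Import GRing.Theory.

Local Open Scope ring_scope.
Local Open Scope classical_set_scope.

(** * Valuation rings from maximal non-unital subalgebras *)

Section ValuationRings.
Context {K : fieldType}.
Implicit Types (D S V W : set K) (x y : K).

Lemma ZarP D V :
  Zar D V <-> [/\ V 1, (forall x y, V x -> V y -> V (x - y)),
    (forall x y, V x -> V y -> V (x * y)), D `<=` V &
    forall x, V x \/ V x^-1].
Proof.
split=> [[[[V1 VB VM] Vdiv] Vquo DV]|[V1 VB VM DV Vinv]].
  split=> //.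
  - by rewrite inE in V1.
  - by move=> x y Vx Vy; have /(_ x y) := VB; rewrite !inE; apply.
  - by move=> x y Vx Vy; have /(_ x y) := VM; rewrite !inE; apply.
  move=> x; have [a [b [Va Vb b0 ->]]] := Vquo x.
  have [[c Vc ->]|[c Vc bE]] := Vdiv b a Vb Va.
    by left; rewrite mulfK.
  by right; rewrite invf_div bE mulfK//; apply: contraNneq b0 => a0;
    rewrite bE a0 mulr0.
have V0 : V 0 by rewrite -(subrr 1); exact: VB.
split=> //; first split.
- split=> [|x y|x y]; rewrite !inE //; [exact: VB|exact: VM].
- move=> a b Va Vb; have [->|a0] := eqVneq a 0.
    by right; exists 0; rewrite ?mul0r.
  have [->|b0] := eqVneq b 0; first by left; exists 0; rewrite ?mul0r.
  have [Vab|Vba] := Vinv (a / b).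
    by right; exists (a / b); rewrite ?divfK.
  by left; exists (b / a); rewrite ?divfK// -invf_div.
- move=> x; have [->|x0] := eqVneq x 0.
    by exists 0, 1; rewrite ?oner_neq0 ?mul0r; split.
  have [Vx|Vx] := Vinv x; first by exists x, 1; rewrite oner_neq0 divr1.
  by exists 1, x^-1; rewrite invr_neq0// invrK mul1r.
Qed.

Lemma Zar_setT D : Zar D [set: K].
Proof. by apply/ZarP; split=> // x; left. Qed.

(** The proper ideals of all the subrings that contain [D], without naming the
  ring: Chevalley's pairs (ring, proper ideal) become single sets, ordered by
  inclusion. *)
Definition proper_subrng D S : Prop :=
  [/\ S 0, (forall x y, S x -> S y -> S (x - y)),
    (forall x y, S x -> S y -> S (x * y)),
    (forall c x, D c -> S x -> S (c * x)) & ~ S 1].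

Definition max_ideal V : set K := [set x | x = 0 \/ ~ V x^-1].

Lemma max_ideal_proper D V : Zar D V -> proper_subrng D (max_ideal V).
Proof.
move=> /ZarP[V1 VB VM DV Vinv].
have MV x y : V x -> max_ideal V y -> max_ideal V (x * y).
  move=> Vx [->|NVy]; first by left; rewrite mulr0.
  have [->|x0] := eqVneq x 0; first by left; rewrite mul0r.
  right=> Vxy; apply: NVy.
  by rewrite -[y^-1](mulKf x0) mulrCA -invfM; exact: VM.
have mV x : max_ideal V x -> V x.
  move=> [->|NVx]; first by rewrite -(subrr 1); exact: VB.
  by have [] := Vinv x.
split=> [|x y mx my|x y mx my|c x Dc mx|[/eqP|]].
- by left.
- have [x0|x0] := eqVneq x 0.
    rewrite x0 sub0r -mulN1r; apply: MV => //; rewrite -sub0r; apply: VB => //.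
    by apply: mV; left.
  have [y0|y0] := eqVneq y 0; first by rewrite y0 subr0.
  have [Vxy|Vyx] := Vinv (x / y).
    have -> : x - y = (x / y - 1) * y by field.
    by apply: MV => //; exact: VB.
  have -> : x - y = (1 - (x / y)^-1) * x by field; rewrite ?x0 ?y0.
  by apply: MV => //; exact: VB.
- by apply: MV => //; exact: mV.
- by apply: MV => //; exact: DV.
- by rewrite oner_eq0.
- by rewrite invr1.
Qed.

Definition idealizer S : set K := [set x | forall s, S s -> S (x * s)].

Section Maximal.
Variables (D S : set K).
Hypothesis pS : proper_subrng D S.
Hypothesis maxS : forall T, proper_subrng D T -> S `<=` T -> T = S.

Let S0 : S 0. Proof. by case: pS. Qed.
Let SB x y : S x -> S y -> S (x - y).
Proof. by case: pS => _ + _ _ _; apply. Qed.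
Let SM x y : S x -> S y -> S (x * y).
Proof. by case: pS => _ _ + _ _; apply. Qed.
Let NS1 : ~ S 1. Proof. by case: pS. Qed.
Let SD x y : S x -> S y -> S (x + y).
Proof. by move=> Sx Sy; rewrite -[y]opprK -[- y]sub0r; apply/SB/SB. Qed.
Let Ssum (n : nat) (f : nat -> K) :
  (forall i, (i < n)%N -> S (f i)) -> S (\sum_(i < n) f i).
Proof. by move=> Sf; apply: (big_ind S) => // -[i ltin] _; exact: Sf. Qed.

(** The set [T] of the values at [x] of the polynomials with coefficients in [S]
  is the ideal generated by [S] in the ring [A[x]], where [A] is the idealizer
  of [S].  If [T] were proper, then it would be [S] by maximality, and [x S],
  being part of [T], would be part of [S]. *)
Lemma poly_unit_of_maximal x : ~ idealizer S x ->
  exists2 p : {poly K}, (forall i, S p`_i) & p.[x] = 1.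
Proof.
move=> NAx.
pose T := [set z | exists2 p : {poly K}, (forall i, S p`_i) & p.[x] = z].
have ST : S `<=` T.
  move=> s Ss; exists s%:P; last by rewrite hornerC.
  by move=> i; rewrite coefC; case: eqP.
apply: contrapT => NT1; apply: NAx => s Ss.
suff <- : T = S.
  exists (s *: 'X); last by rewrite hornerZ hornerX mulrC.
  by move=> i; rewrite coefZ coefX; case: eqP; rewrite ?mulr1 ?mulr0.
apply: maxS => //; split=> [|_ _ [p Sp <-] [q Sq <-]|_ _ [p Sp <-] [q Sq <-]
  |c _ Dc [p Sp <-]|//].
- exact: ST.
- by exists (p - q); [move=> i; rewrite coefB; exact: SB|rewrite !hornerE].
- exists (p * q); last by rewrite hornerM.
  move=> i; rewrite coefM.
  by apply: (Ssum _ (fun j => p`_j * q`_(i - j))) => j _; exact: SM.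
- exists (c *: p); last by rewrite hornerZ.
  by move=> i; rewrite coefZ; case: pS => _ _ _ + _; apply.
Qed.

(** [S] lies in the Jacobson radical of its idealizer.  Otherwise
  [1 = \sum_i p_i (1 - s) ^ (- i)] with [p_i] in [S]; clearing denominators puts
  a power of [1 - s] in [S], but such a power is congruent to [1] modulo [S]. *)
Lemma inv_one_sub s : S s -> idealizer S (1 - s)^-1.
Proof.
move=> Ss; apply: contrapT => /poly_unit_of_maximal[p Sp].
have s1 : 1 - s != 0 by rewrite subr_eq0; apply/eqP => s1; rewrite -s1 in Ss.
have mulA n t : S t -> S ((1 - s) ^+ n * t).
  elim: n t => [|n IHn] t St; first by rewrite mul1r.
  by rewrite exprSr -mulrA mulrBl mul1r; apply: IHn; apply: SB => //; exact: SM.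
have pow n : S (1 - (1 - s) ^+ n).
  elim: n => [|n IHn]; first by rewrite expr0 subrr.
  have -> : 1 - (1 - s) ^+ n.+1 = (1 - (1 - s) ^+ n) + (1 - s) ^+ n * s.
    by rewrite exprSr; ring.
  by apply: SD => //; exact: mulA.
rewrite horner_coef => p1; apply: NS1.
rewrite -(subrK ((1 - s) ^+ size p) 1); apply: SD => //.
have -> : (1 - s) ^+ size p =
    \sum_(i < size p) (1 - s) ^+ size p * (p`_i * (1 - s)^-1 ^+ i).
  by rewrite -mulr_sumr p1 mulr1.
apply: (Ssum _ (fun i => (1 - s) ^+ size p * (p`_i * (1 - s)^-1 ^+ i))) => i ?.
rewrite mulrCA exprVn -expfB//; first by rewrite mulrC; exact: mulA.
Qed.

Definition unit_relation n x :=
  exists p : {poly K}, [/\ forall i, S p`_i, (size p <= n.+1)%N & p.[x] = 1].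

(** The degree reduction in Chevalley's theorem: since [1 - q_0] is invertible
  in the idealizer, the relation on [x^-1] writes [p_(n+1) x ^ (n+1)] as a
  combination of lower powers of [x] with coefficients in [S], and this
  eliminates the top term of the relation on [x]. *)
Lemma unit_relation_step n x : x != 0 ->
  unit_relation n.+1 x -> unit_relation n.+1 x^-1 -> unit_relation n x.
Proof.
move=> x0 [p [Sp szp px]] [q [Sq szq qx]].
pose u := (1 - q`_0)^-1; have Au : idealizer S u by exact: inv_one_sub.
have u0 : 1 - q`_0 != 0.
  by rewrite subr_eq0; apply/eqP => q1; apply: NS1; rewrite q1.
pose c i := p`_i + u * p`_n.+1 * q`_(n.+1 - i).
exists (\poly_(i < n.+1) c i); split; last 2 first.
- exact: size_poly.
- rewrite horner_poly -[RHS]px (horner_coef_wide _ szp) [RHS]big_ord_recr/=.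
  under eq_bigr do rewrite mulrDl; rewrite big_split/=; congr (_ + _).
  under eq_bigr do rewrite -[_ * x ^+ _]mulrA; rewrite -mulr_sumr.
  have qE : 1 - q`_0 = \sum_(i < n.+1) q`_i.+1 * x^-1 ^+ i.+1.
    rewrite -{1}qx (horner_coef_wide _ szq) big_ord_recl/= expr0 mulr1.
    by rewrite addrC addKr.
  have -> : \sum_(i < n.+1) q`_(n.+1 - i) * x ^+ i = x ^+ n.+1 * (1 - q`_0).
    rewrite qE mulr_sumr (reindex_inj rev_ord_inj)/=; apply: eq_bigr => i _.
    have lein : (i <= n)%N by rewrite -ltnS.
    rewrite subSS (subSn (leq_subr _ _)) subKn// mulrCA; congr (_ * _).
    by rewrite exprVn -exprB ?unitfE ?ltnS// subSS.
  by rewrite /u; field.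
- move=> i; rewrite coef_poly; case: ifP => // _; apply: SD => //.
  by apply: SM => //; exact: Au.
Qed.

(** If both [x] and [x^-1] were outside the idealizer, both would satisfy
  relations of a common degree, which can be lowered to degree [0]; a relation
  of degree [0] says that [1] is in [S]. *)
Lemma idealizer_total x : idealizer S x \/ idealizer S x^-1.
Proof.
have rel y : ~ idealizer S y -> exists n, unit_relation n y.
  move=> /poly_unit_of_maximal[p Sp py]; exists (size p).
  by exists p; split=> //; exact: leqnSn.
have [->|x0] := eqVneq x 0; first by left=> s _; rewrite mul0r.
apply: contrapT => /not_orP[/rel[n rx] /rel[m rx']].
have widen i j y : (i <= j)%N -> unit_relation i y -> unit_relation j y.
  move=> ij [p [Sp szp py]]; exists p; split=> //.
  exact: leq_trans szp _.
have {}rx : unit_relation (maxn n m) x by apply: widen rx; exact: leq_maxl.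
have {}rx' : unit_relation (maxn n m) x^-1.
  by apply: widen rx'; exact: leq_maxr.
elim: (maxn n m) rx rx' => [|k IHk] rx rx'.
  case: rx => p [Sp szp]; rewrite (size1_polyC szp) hornerC => p1.
  by apply: NS1; rewrite -p1.
apply: IHk; apply: unit_relation_step; rewrite ?invrK ?invr_neq0//.
Qed.

(** For [W] inside the idealizer, [max_ideal W] contains [S], hence equals [S]
  by maximality; and a valuation ring is determined by its maximal ideal. *)
Lemma idealizer_min : Zar_min D (idealizer S).
Proof.
split=> [|W ZW WA].
  apply/ZarP; split=> [s|x y Ax Ay s Ss|x y Ax Ay s Ss|c Dc s Ss|x].
  - by rewrite mul1r.
  - by rewrite mulrBl; apply: SB; [exact: Ax|exact: Ay].
  - by rewrite -mulrA; exact/Ax/Ay.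
  - by case: pS => _ _ _ + _; apply.
  - exact: idealizer_total.
have mWS : max_ideal W = S.
  apply: maxS; first exact: max_ideal_proper.
  move=> x Sx; have [->|x0] := eqVneq x 0; first by left.
  by right=> /WA /(_ _ Sx); rewrite mulVf.
apply/seteqP; split=> // x Ax; apply: contrapT => NWx.
have Sx' : S x^-1 by rewrite -mWS; right; rewrite invrK.
have x0 : x != 0.
  apply: contra_notN NWx => /eqP ->.
  have /ZarP[W1 WB _ _ _] := ZW.
  by rewrite -(subrr 1); exact: WB.
by apply: NS1; rewrite -(mulfV x0); exact: Ax.
Qed.

End Maximal.

(** Zorn's lemma followed by [idealizer_min]. The order is on the sets [X] such
  that [S0 `|` X] is proper, and not on the proper sets containing [S0], so that
  the empty chain has the empty set as an upper bound. *)
Lemma Zar_min_dominating D S0 : proper_subrng D S0 ->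
  exists2 V, Zar_min D V & forall x, S0 x -> V x /\ (x != 0 -> ~ V x^-1).
Proof.
move=> pS0.
have [|X [pX maxX]] := @Zorn_bigcup K (fun X => proper_subrng D (S0 `|` X)).
  move=> C CP totC; set U := \bigcup_(X in C) X.
  have cover x : (S0 `|` U) x ->
      exists X, [/\ X = set0 \/ C X, (S0 `|` X) x & proper_subrng D (S0 `|` X)].
    move=> [S0x|[X CX Xx]].
      by exists set0; rewrite setU0; split=> //; left.
    by exists X; split; [right|right|exact: CP].
  have subU X : X = set0 \/ C X -> S0 `|` X `<=` S0 `|` U.
    move=> [->|CX]; first by rewrite setU0; exact: subsetUl.
    by apply: setUS; exact: bigcup_sup.
  have common x y : (S0 `|` U) x -> (S0 `|` U) y -> exists X,
      [/\ S0 `|` X `<=` S0 `|` U, (S0 `|` X) x, (S0 `|` X) y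
        & proper_subrng D (S0 `|` X)].
    move=> /cover[X [CX Xx pX]] /cover[Y [CY Yy pY]].
    have [XY|YX] : X `<=` Y \/ Y `<=` X.
      case: CX CY => [->|CX] [->|CY]; try by [left|right].
      exact: totC.
    - exists Y; split=> //; first exact: subU.
      by move: Xx; apply: setUS.
    - exists X; split=> //; first exact: subU.
      by move: Yy; apply: setUS.
  split=> [|x y /common/[apply]-[X [XU Xx Xy [_ SB _ _ _]]]
           |x y /common/[apply]-[X [XU Xx Xy [_ _ SM _ _]]]
           |c x Dc /cover[X [CX Xx [_ _ _ SZ _]]]
           |/cover[X [_ X1 [_ _ _ _]]]//].
  - by left; case: pS0.
  - exact/XU/SB.
  - exact/XU/SM.
  - exact/(subU _ CX)/SZ.
set S := S0 `|` X.
have maxS T : proper_subrng D T -> S `<=` T -> T = S.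
  move=> pT ST; have S0T : S0 `|` T = T.
    by apply/setUidPr => x S0x; apply: ST; left.
  have XT : X `<=` T by move=> x Xx; apply: ST; right.
  have [TX|TX] := pselect (T `<=` X); last first.
    by case: (maxX T); [split|rewrite S0T].
  by apply/seteqP; split=> // x /TX Xx; right.
exists (idealizer S); first exact: idealizer_min.
have [_ _ SM _ NS1] := pX.
move=> x S0x; have Sx : S x by left.
split=> [s Ss|x0 /(_ _ Sx)]; first exact: SM.
by rewrite mulVf.
Qed.

End ValuationRings.

(** * The elements of positive weight *)

Section Weights.
Context {F L : fieldType} {R : comNzRingType}.
Variables (iota : {rmorphism F -> L}) (C : F -> R).
Variables (ev : {rmorphism R -> L}) (phi : {rmorphism R -> {poly L}}).

(** The fractions [p / q] with [ord (phi p) > ord (phi q)], where [ord] is the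
  order of vanishing at [0]; thus [p |-> ord (phi p)] plays the role of a
  valuation on [R], transported to [L] by [ev].  For [R] a polynomial ring and
  [phi] the substitution that multiplies each variable by a power of ['X], this
  is a monomial valuation. *)
Definition positive_weight : set L :=
  [set x | exists (p q : R) (k : nat) (r t : {poly L}),
  [/\ x * ev q = ev p, phi q = 'X^k * r, r.[0] != 0 & phi p = 'X^(k.+1) * t]].

Hypothesis ev_inj : injective ev.
Hypotheses (evC : forall c, ev (C c) = iota c)
           (phiC : forall c, phi (C c) = (iota c)%:P).

(** The stability properties are those of a valuation; [1] is excluded because
  [ev q = ev p] forces [q = p], whereas [phi q] and [phi p] vanish to different
  orders. *)
Lemma positive_weight_proper : proper_subrng (range iota) positive_weight.
Proof.
split=> [|x x' [p [q [k [r [t [xq qE r0 pE]]]]]]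
             [p' [q' [k' [r' [t' [xq' qE' r0' pE']]]]]]
         |x x' [p [q [k [r [t [xq qE r0 pE]]]]]]
             [p' [q' [k' [r' [t' [xq' qE' r0' pE']]]]]]
         |_ x [c _ <-] [p [q [k [r [t [xq qE r0 pE]]]]]]
         |[p [q [k [r [t [xq qE r0 pE]]]]]]].
- exists 0, 1, 0%N, 1, 0.
  by rewrite !rmorph0 !rmorph1 mul0r mulr0 expr0 mulr1 hornerC oner_neq0.
- exists (p * q' - p' * q), (q * q'), (k + k')%N, (r * r'), (t * r' - t' * r).
  split.
  + by rewrite rmorphB !rmorphM -xq -xq'; ring.
  + by rewrite rmorphM qE qE' exprD; ring.
  + by rewrite hornerM mulf_neq0.
  + by rewrite rmorphB !rmorphM qE qE' pE pE' !exprS exprD; ring.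
- exists (p * p'), (q * q'), (k + k')%N, (r * r'), ('X * (t * t')); split.
  + by rewrite !rmorphM -xq -xq'; ring.
  + by rewrite rmorphM qE qE' exprD; ring.
  + by rewrite hornerM mulf_neq0.
  + by rewrite rmorphM pE pE' !exprS exprD; ring.
- exists (C c * p), q, k, r, ((iota c)%:P * t); split=> //.
  + by rewrite rmorphM evC -xq mulrA.
  + by rewrite rmorphM phiC pE mulrCA.
- move: xq; rewrite mul1r => /ev_inj qp.
  have : 'X^k * r = 'X^k * ('X * t) by rewrite -qE qp pE exprSr mulrA.
  have Xk0 : 'X^k != 0 :> {poly L} by rewrite expf_neq0 ?polyX_eq0.
  move=> /(mulfI Xk0) rE.
  by move: r0; rewrite rE hornerM hornerX mul0r eqxx.
Qed.

Lemma positive_weightP p q k r t : phi q = 'X^k * r -> r.[0] != 0 ->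
  phi p = 'X^(k.+1) * t -> positive_weight (ev p / ev q).
Proof.
move=> qE r0 pE; exists p, q, k, r, t; split=> //; rewrite divfK//.
apply: contra_neq r0 => evq0.
have q0 : q = 0 by apply: ev_inj; rewrite rmorph0.
move: qE; rewrite q0 rmorph0 => /esym/eqP.
by rewrite mulf_eq0 expf_eq0 polyX_eq0 andbF/= => /eqP ->; rewrite horner0.
Qed.

End Weights.

(** * Valuation rings of a field extension *)

Section Transcendence.
Context {F L : fieldType}.
Variable iota : {rmorphism F -> L}.

(** With [s = v ord0] of weight [2] and [t = v ord_max] of weight [2n+1], both
  [s ^ (n+1) / t] and the [t / s ^ (i+1)] with [i < n] have positive weight, so
  they lie in the maximal ideal of a minimal valuation ring. *)
Lemma Zar_min_separating (v : 'I_2 -> L) :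
  (forall p : mpoly 2 F, mmap iota v p = 0 -> p = 0) ->
  forall n, exists2 V, Zar_min (range iota) V &
    V (v ord0 ^+ n.+1 / v ord_max) /\
    forall i, (i < n)%N -> ~ V (v ord0 ^+ i.+1 / v ord_max).
Proof.
move=> vfree n; pose w (j : 'I_2) := if j == ord0 then 2%N else n.*2.+1.
have vE j : mmap iota v (mpolyX F (mnm1 j)) = v j by rewrite mmapX mmap1U.
have v0 j : v j != 0.
  apply/eqP => vj0; have /vfree : mmap iota v (mpolyX F (mnm1 j)) = 0.
    by rewrite vE.
  move=> /(congr1 (mcoeff (mnm1 j)))/eqP.
  by rewrite mcoeffX eqxx mcoeff0 oner_eq0.
pose h j : {poly L} := v j *: 'X^(w j).
pose ev : {rmorphism mpoly 2 F -> L} := mmap iota v.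
pose phi : {rmorphism mpoly 2 F -> {poly L}} := mmap (polyC \o iota) h.
have hE j : phi (mpolyX F (mnm1 j)) = h j by rewrite [LHS]mmapX mmap1U.
have ev_inj : injective ev.
  by move=> p q /eqP; rewrite -subr_eq0 -rmorphB => /eqP/vfree/subr0_eq.
pose C := @mpolyC 2 F.
have evC c : ev (C c) = iota c by rewrite [LHS]mmapC.
have phiC c : phi (C c) = (iota c)%:P by rewrite [LHS]mmapC.
have pP := positive_weightP ev phi ev_inj.
have [V Vmin domV] :=
  Zar_min_dominating _ _ (positive_weight_proper iota C ev phi ev_inj evC phiC).
pose X (j : 'I_2) := mpolyX F (mnm1 j); have evX j : ev (X j) = v j := vE j.
exists V => //; split=> [|i ltin].
  suff /domV[] : positive_weight ev phi (v ord0 ^+ n.+1 / v ord_max) by [].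
  rewrite -!evX -rmorphXn/=.
  apply: (pP _ _ n.*2.+1 (v ord_max)%:P (v ord0 ^+ n.+1)%:P).
  - by rewrite hE /h mulrC -mul_polyC.
  - by rewrite hornerC.
  - by rewrite rmorphXn hE /h exprZn -exprM -mul_polyC mulrC mul2n doubleS.
suff /domV[_] : positive_weight ev phi (v ord_max / v ord0 ^+ i.+1).
  rewrite invf_div; apply.
  by rewrite mulf_neq0 ?invr_neq0 ?expf_neq0.
rewrite -!evX -rmorphXn/=.
apply: (pP _ _ i.+1.*2 (v ord0 ^+ i.+1)%:P (v ord_max *: 'X^((n - i.+1).*2))).
- by rewrite rmorphXn hE /h exprZn -exprM -mul_polyC mulrC mul2n.
- by rewrite hornerC expf_neq0.
- by rewrite hE /h -scalerAr -exprD addSn -doubleD subnKC.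
Qed.

(** Integral closure of [V], for a relation [p] in at most one variable: the
  form in which a failure of algebraic independence of the singleton of [x] is
  given, since an injective family of elements equal to [x] has at most one
  member.  If [y = x^-1] is in [V], the relation divided by its leading
  coefficient and by [x ^ (d - 1)], with [d] its degree, expresses [x] as a
  polynomial in [y]. *)
Lemma root_in_valuation V n (v : 'I_n -> L) x (p : mpoly n F) :
  Zar (range iota) V -> (n <= 1)%N -> (forall i, v i = x) ->
  p != 0 -> mmap iota v p = 0 -> V x.
Proof.
move=> /ZarP[V1 VB VM FV Vinv] len1 vx p0 pv0.
have V0 : V 0 by rewrite -(subrr 1); exact: VB.
have VD y z : V y -> V z -> V (y + z).
  by move=> Vy Vz; rewrite -[z]opprK -[- z]sub0r; apply/VB/VB.
have VX y k : V y -> V (y ^+ k).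
  by move=> Vy; elim: k => [|k IHk] //; rewrite exprS; exact: VM.
have [//|Vx'] := Vinv x; have [->//|x0] := eqVneq x 0.
have m1E m : mmap1 v m = x ^+ mdeg m.
  by rewrite mdegE expr_sum; apply: eq_bigr => i _; rewrite vx.
(* At most one variable: monomials are determined by their degree, so all the
  non-leading ones have degree smaller than the leading one. *)
have mdeg_inj : injective (@mdeg n).
  move=> m m' mm'; apply/mnmP => i.
  have mdegi (k : multinom n) : mdeg k = k i.
    rewrite mdegE (bigD1 i)//= big1 ?addn0// => j ji; exfalso.
    move: ji; apply/negP/negPn/eqP/val_inj => /=.
    move: (ltn_ord i) (ltn_ord j) => /leq_trans/(_ len1) + /leq_trans/(_ len1).
    by rewrite !ltnS !leqn0 => /eqP -> /eqP ->.
  by rewrite -!mdegi.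
have lt_mdeg m : m \in msupp p -> m != mlead p -> (mdeg m < mdeg (mlead p))%N.
  move=> mp mNl; rewrite ltn_neqAle (inj_eq mdeg_inj) mNl/=.
  exact/lemc_mdeg/msupp_le_mlead.
have cE : iota (mleadc p) * x ^+ mdeg (mlead p) =
    - \sum_(m <- msupp p | m != mlead p) iota (mcoeff m p) * x ^+ mdeg m.
  apply/eqP; rewrite -addr_eq0; apply/eqP; rewrite -[RHS]pv0.
  rewrite /mmap (bigD1_seq (mlead p))/= ?msupp_uniq ?mlead_supp//.
  by congr (_ + _); [|apply: eq_bigr => m _]; rewrite m1E.
have c0 : iota (mleadc p) != 0 by rewrite fmorph_eq0 mleadc_eq0.
case: (mdeg (mlead p)) lt_mdeg cE => [|d] lt_mdeg cE.
  suff /eqP : iota (mleadc p) = 0 by rewrite (negPf c0).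
  move: cE; rewrite mulr1 => ->; rewrite big_seq_cond big1 ?oppr0// => m.
  by move=> /andP[/lt_mdeg lt0 /lt0].
have -> : x = - \sum_(m <- msupp p | m != mlead p)
    iota (mcoeff m p / mleadc p) * x^-1 ^+ (d - mdeg m).
  have xd0 : x ^+ d != 0 by rewrite expf_neq0.
  apply: (mulfI (mulf_neq0 c0 xd0)); rewrite -mulrA -exprSr cE.
  rewrite mulrN mulr_sumr; congr (- _); rewrite big_seq_cond [RHS]big_seq_cond.
  apply: eq_bigr => m /andP[mp mNl].
  have led : (mdeg m <= d)%N by rewrite -ltnS lt_mdeg.
  rewrite fmorph_div mulrACA [_ * (_ / _)]mulrC divfK//; congr (_ * _).
  by rewrite exprVn -exprB ?unitfE ?leq_subr// subKn.
rewrite -sub0r; apply: VB => //; rewrite big_seq_cond.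
apply: (big_ind V) => // m _; apply: VM; last exact: VX.
by apply: FV; exists (mcoeff m p / mleadc p).
Qed.

End Transcendence.

(** * Noetherian spaces and the Zariski topology *)

Lemma noetherian_subsingleton (T : topologicalType) :
  (forall x y : T, x = y) -> noetherian_space T.
Proof.
move=> T1 U _ Uinc.
have Umono m n : (m <= n)%N -> U m `<=` U n.
  move=> /subnK <-; elim: (n - m)%N => // k IHk.
  exact: subset_trans (Uinc _).
have [[N [x UNx]]|U0] := pselect (exists N, U N !=set0).
  exists N => n Nn; apply/seteqP; split; last exact: Umono.
  by move=> y _; rewrite (T1 y x).
exists 0%N => n _; apply/seteqP; split=> x Ux; exfalso; apply: U0.
- by exists n, x.
- by exists 0%N, x.
Qed.

Lemma not_noetherian_of_separated (T : topologicalType) (O : nat -> set T) :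
  (forall n, open (O n)) ->
  (forall n, exists x, O n x /\ forall i, (i < n)%N -> ~ O i x) ->
  ~ noetherian_space T.
Proof.
move=> Oopen Osep noeth.
have [|n|N UN] := noeth (fun n => \bigcup_(i in `I_n) O i).
- by move=> n; apply: bigcup_open => i _; exact: Oopen.
- by apply: bigcup_sub => i /= ltin; apply: bigcup_sup => /=; exact: ltnW.
have [x [ONx sepx]] := Osep N.
have : (\bigcup_(i in `I_N.+1) O i) x by exists N => //=.
rewrite (UN _ (leqnSn N)) => -[i /= ltiN Oi].
exact: sepx ltiN Oi.
Qed.

Lemma open_zar_subbase (K : fieldType) (D : set K) (xs : seq K) :
  open (@zar_subbase K D xs).
Proof.
exists [set @zar_subbase K D xs]; last by rewrite bigcup_set1.
move=> _ ->; exists [fset @zar_subbase K D xs]%fset.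
  by move=> U /fset1P ->; rewrite inE; exists xs.
by rewrite set_fset1 bigcap_set1.
Qed.

Lemma mem_zar_subbase1 (K : fieldType) (D : set K) x (V : zar_space D) :
  zar_subbase [:: x] V <-> set_val V x.
Proof.
split=> [|Vx y /=]; first by apply; rewrite /= inE.
by rewrite inE => /eqP ->.
Qed.

Theorem proposition4p1 (F L : fieldType) (iota : {rmorphism F -> L}) :
  (trdeg_eq iota 0 ->
     [/\ Zar (range iota) = [set [set: L]],
         Zar_min (range iota) = [set [set: L]],
         noetherian_space (zar_space (range iota)) &
         noetherian_space (zar_min_space (range iota))]) /\
  (trdeg_ge iota 2 ->
     ~ noetherian_space (zar_space (range iota)) /\
     ~ noetherian_space (zar_min_space (range iota))).
Proof.
split=> [[B [_ maxB]]|[B [Bindep _] /card_leP[f]]].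
  rewrite II0 card_eq0 => /eqP B0.
  have ZarT V : Zar (range iota) V -> V = [set: L].
    move=> ZV; apply/seteqP; split=> // x _; apply: contrapT => NVx.
    suff /maxB : algebraically_independent iota [set x].
      by rewrite B0 => /(_ (@sub0set _ _)) /seteqP[/(_ x erefl)].
    move=> n v vinj vx p pv0; apply: contrapT => /eqP p0; apply: NVx.
    apply: (root_in_valuation iota V n v x p ZV _ vx p0 pv0).
    rewrite leqNgt; apply/negP => n1.
    have /vinj/(congr1 val)// : v (Ordinal (ltnW n1)) = v (Ordinal n1).
    by rewrite !vx.
  have eqZ (V W : zar_space (range iota)) : V = W.
    by apply: val_inj; rewrite (ZarT _ (set_valP V)) (ZarT _ (set_valP W)).
  split.
  - apply/seteqP; split=> [V /ZarT //|_ ->]; exact: Zar_setT.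
  - apply/seteqP; split=> [V [/ZarT //]|_ ->].
    by split=> [|W /ZarT]; first exact: Zar_setT.
  - exact: noetherian_subsingleton.
  - by apply: noetherian_subsingleton => V W; apply: val_inj; exact: eqZ.
pose v (i : 'I_2) : L := set_val (f (exist _ (i : nat) (mem_set (ltn_ord i)))).
have vinj : injective v.
  move=> i j /val_inj /(inj (f := f)) => /(_ (mem_set I) (mem_set I)).
  by case=> /val_inj.
have sep := Zar_min_separating iota v
  (Bindep 2 v vinj (fun i => set_valP _)).
pose D := range iota.
pose O i : set (zar_space D) := zar_subbase [:: v ord0 ^+ i.+1 / v ord_max].
have Oopen i : open (O i) by exact: open_zar_subbase.
have Osep n : exists V : zar_min_space D,
    O n (set_val V) /\ forall i, (i < n)%N -> ~ O i (set_val V).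
  have [V Vmin [Vn Vi]] := sep n.
  pose V' : zar_space D := exist _ V (mem_set Vmin.1).
  exists (exist _ V' (mem_set Vmin)); split; first exact/mem_zar_subbase1.
  by move=> i /Vi NVi /mem_zar_subbase1.
split.
- apply: (not_noetherian_of_separated _ O) => // n.
  by have [V VO] := Osep n; exists (set_val V).
- apply: (not_noetherian_of_separated _ (fun i => set_val @^-1` O i)) => // i.
  by exists (O i).
Qed.
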